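(* Let $H$ be a finite set of unit vectors in $\mathbb{R}^d$ not contained in any closed half of the unit sphere, and let $k=|H|$. Let $S\subset\mathbb{R}^d$ be a discrete point set and $\mathcal{F}$ a finite family of $H$-convex sets with $|\mathcal{F}|\ge k$. If the intersection of any $k$ sets of $\mathcal{F}$ contains a point of $S$, then $\bigcap\mathcal{F}$ contains a point of $S$.
   Context: For a set $H\subseteq S^{d-1}$ of unit vectors not contained in any closed half-sphere, a set in $\mathbb{R}^d$ is $H$-convex if it can be written as an intersection of halfspaces of the form $\{x\in\mathbb{R}^d:\langle x,h\rangle\le c\}$ with $h\in H$ and $c\in\mathbb{R}$. *)

(* Defs.v *)
From mathcomp Require Import all_boot all_order all_algebra.
From mathcomp Require Import finmap.
From mathcomp Require Import all_classical all_reals all_analysis.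

Set Implicit Arguments.
Unset Strict Implicit.
Unset Printing Implicit Defensive.

Import Order.TTheory GRing.Theory Num.Theory.
Import numFieldNormedType.Exports.

Local Open Scope classical_set_scope.
Local Open Scope ring_scope.

Definition dotp (R : realType) (d : nat) (x y : 'rV[R]_d) : R :=
  \sum_(i < d) x ord0 i * y ord0 i.

(* The library's norm on ['rV[R]_d] is the sup norm, so the Euclidean norm is
   spelled out here; both norms induce the same topology. *)
Definition unit_sphere (R : realType) (d : nat) : set 'rV[R]_d :=
  [set x | Num.sqrt (dotp x x) = 1].

Definition closed_half_sphere (R : realType) (d : nat) (u : 'rV[R]_d) :
  set 'rV[R]_d := @unit_sphere R d `&` [set x | 0 <= dotp x u].

Definition halfspace (R : realType) (d : nat) (h : 'rV[R]_d) (c : R) :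
  set 'rV[R]_d := [set x | dotp x h <= c].

(* Arbitrary intersections: [P] may be empty (giving the whole space) or
   infinite, and may use a direction several times. *)
Definition Hconvex (R : realType) (d : nat) (H : set 'rV[R]_d)
    (A : set 'rV[R]_d) : Prop :=
  exists P : set ('rV[R]_d * R),
    (forall p, P p -> H p.1) /\ A = \bigcap_(p in P) halfspace p.1 p.2.

(* [S] is discrete in the subspace topology: each of its points is isolated.
   Locally finite sets are a special case. *)
Definition discrete_set (T : topologicalType) (S : set T) : Prop :=
  S `<=` isolated S.

(* Main.v *)
(* An H-convex set is cut out by one inequality <x,h> <= c(h) per direction h
   in H, where c(h) is an infimum in the extended reals. For each h pick the
   member of the family with the smallest c(h): these at most k members have the
   same intersection as the whole family, so any k members including them yield
   the required point of S. *)
Require Import Defs.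
From mathcomp Require Import all_boot all_order all_algebra.
From mathcomp Require Import finmap.
From mathcomp Require Import all_classical all_reals all_analysis.

Set Implicit Arguments.
Unset Strict Implicit.
Unset Printing Implicit Defensive.

Import Order.TTheory GRing.Theory Num.Theory.
Import numFieldNormedType.Exports.

Local Open Scope classical_set_scope.
Local Open Scope ring_scope.

(** Needed because the chosen minimizers may number fewer than [k], while [F_k] speaks of exactly
    [k] indices. *)
Lemma extend_set_to_card (I : finType) (A : {set I}) (k : nat) :
  (#|A| <= k <= #|I|)%N -> exists2 B : {set I}, A \subset B & #|B| = k.
Proof.
case/andP=> Ak; elim: k Ak => [|k IHk] Ak kI.
  by exists A => //; move: Ak; rewrite leqn0 => /eqP.
move: Ak; rewrite leq_eqVlt => /predU1P[<-|Ak]; first by exists A.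
have [B AB Bk] := IHk Ak (ltnW kI).
have /card_gt0P[x] : (0 < #|~: B|)%N by rewrite cardsCs finset.setCK Bk subn_gt0.
rewrite finset.in_setC => xB; exists (x |: B)%SET.
  exact: fintype.subset_trans AB (finset.subsetUr _ _).
by rewrite cardsU1 xB Bk.
Qed.

(** The value is [+oo] when [P] does not constrain direction [h], and [-oo] when its bounds there
    are unbounded below, which makes the intersection empty. *)
Definition offset (R : realType) (d : nat) (P : set ('rV[R]_d * R))
  (h : 'rV[R]_d) : \bar R := ereal_inf [set c%:E | c in [set c | P (h, c)]].

Lemma bigcap_halfspaceP (R : realType) (d : nat) (P : set ('rV[R]_d * R))
    (x : 'rV[R]_d) :
  (\bigcap_(p in P) halfspace p.1 p.2) x <->
  forall h, ((dotp x h)%:E <= offset P h)%E.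
Proof.
split=> [Px h | xP [h c] Phc].
  by apply: le_ereal_inf_tmp => _ [c Phc <-]; rewrite lee_fin; exact: (Px (h, c)).
rewrite /halfspace/= -lee_fin; apply: le_trans (xP h) _.
by apply: ereal_inf_lbound; exists c.
Qed.

Theorem theorem5p2 (R : realType) (d : nat) (H : {fset 'rV[R]_d}) (k : nat)
    (H_unit : [set` H] `<=` @unit_sphere R d)
    (H_spread : forall u : 'rV[R]_d, @unit_sphere R d u ->
       ~ ([set` H] `<=` closed_half_sphere u))
    (k_def : k = #|` H|)
    (S : set 'rV[R]_d) (S_discrete : discrete_set S)
    (I : finType) (F : I -> set 'rV[R]_d)
    (F_convex : forall i, Hconvex [set` H] (F i))
    (F_card : (k <= #|I|)%N)
    (F_k : forall J : {set I}, #|J| = k ->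
       (\bigcap_(i in [set` J]) F i) `&` S !=set0) :
  (\bigcap_i F i) `&` S !=set0.
Proof.
have [P PH] := boolp.choice F_convex.
suff [J Jk JF] : exists2 J : {set I}, #|J| = k &
    \bigcap_(i in [set` J]) F i `<=` \bigcap_i F i.
  have [x [xJ Sx]] := F_k J Jk.
  by exists x; split=> //; exact: JF.
(* The [arg min] below needs some index [i0]. If [I] is empty, [F_card] forces [k] to be 0 and the
   empty [J] serves. *)
case: (pickP (mem I)) => [i0 _ | I0]; last first.
  have I_card : #|I| = 0%N by exact: eq_card0.
  exists finset.set0; last by move=> x _ i; have := I0 i.
  by apply/esym/eqP; rewrite cards0 -leqn0 -I_card.
pose f h := [arg min_(i < i0) offset (P i) h]%O.
(* Only an inequality: one member may be the minimizer for several directions. *)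
have f_card : (#|[set:: [seq f h | h <- H]]%SET| <= k)%N.
  by rewrite cardsE k_def (leq_trans (card_size _)) ?size_map.
have [|J fJ Jk] := @extend_set_to_card _ [set:: [seq f h | h <- H]]%SET k.
  by rewrite f_card.
exists J => // x xJ i _; have [PiH ->] := PH i.
move=> [h c] Phc.
have hH : h \in H := PiH _ Phc.
have /xJ : [set` J] (f h).
  by apply: (fintype.subsetP fJ); rewrite inE map_f.
have [_ ->] := PH (f h).
move=> /bigcap_halfspaceP/(_ h) xh.
rewrite /halfspace/= -lee_fin; apply: le_trans xh _.
(* The chain is [dotp x h <= offset (P (f h)) h <= offset (P i) h <= c], the middle step by
   minimality of [f h]. *)
rewrite /f; case: arg_minP => // j _ /(_ i isT) /le_trans; apply.
by apply: ereal_inf_lbound; exists c.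
Qed.
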